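(* For $n\ge1$ let $L_n=\langle\gamma_n(W),F\rangle\le W$. Then $L_n$ is a layered group of height $n-1$, and $\mathrm{Aut}^m(L_n)=L_{n-m}$ for all $m\in\{0,\dots,n-1\}$.
   Context: $W$ is the isometry group of the binary rooted tree $X^*$, $X=\{0,1\}$; $\gamma_n(W)$ is the $n$-th term of the lower central series of $W$ ($\gamma_1(W)=W$). For $v\in X^*$ and $g\in W$, $v*g$ acts as $g$ on the subtree below $v$ and fixes other vertices; $F=\langle v*\sigma:v\in X^*\rangle$ is the finitary group, where $\sigma$ swaps the two subtrees at the root rigidly. $L\le W$ is layered if it is transitive on each level $X^k$ and $x*L\le L$ for $x\in X$. The automorphism tower $\mathrm{Aut}^m$ is realized inside $W$ via conjugation (as the normalizer tower in $W$); the height is the least $\alpha$ with $\mathrm{Aut}^\alpha=\mathrm{Aut}^{\alpha+1}$. *)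

(* Defs.v *)
(* Elements of the binary rooted tree X^* are
   words [seq bool]; tree automorphisms are maps on words. Subsets of W are
   predicates on such maps. *)
From mathcomp Require Import all_boot.
Set Implicit Arguments. Unset Strict Implicit. Unset Printing Implicit Defensive.

Definition elt := seq bool -> seq bool.
Definition eset := elt -> Prop.

(* g is an isometry (automorphism) of the rooted tree X^*: bijective,
   length preserving, and preserving the prefix order. *)
Definition isW (g : elt) : Prop :=
  bijective g /\ (forall u, size (g u) = size u) /\
  (forall u v, take (size u) (g (u ++ v)) = g u).

Definition inv_elt (g h : elt) : Prop := forall u, g (h u) = u /\ h (g u) = u.

Definition subgroup (H : eset) : Prop :=
  (forall g, H g -> isW g) /\ H id /\
  (forall g h, H g -> H h -> H (g \o h)) /\
  (forall g, H g -> exists h, H h /\ inv_elt g h).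

Definition gen (S : eset) : eset :=
  fun g => forall H, subgroup H -> (forall s, S s -> H s) -> H g.

Definition seteq (A B : eset) : Prop := forall g, A g <-> B g.

Definition comm_set (A B : eset) : eset :=
  fun c => exists a b a' b', A a /\ B b /\ inv_elt a a' /\ inv_elt b b' /\
    forall u, c u = a' (b' (a (b u))).

(* gam k = gamma_{k+1}(W) *)
Fixpoint gam (k : nat) : eset :=
  match k with
  | 0 => isW
  | k'.+1 => gen (comm_set (gam k') isW)
  end.

Definition gamma (n : nat) : eset := gam n.-1.

Definition vstar (v : seq bool) (g : elt) : elt :=
  fun u => if take (size v) u == v then v ++ g (drop (size v) u) else u.

Definition sigma : elt :=
  fun u => match u with [::] => [::] | x :: w => (~~ x) :: w end.

Definition Fin : eset := gen (fun g => exists v, g = vstar v sigma).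

Definition Lgrp (n : nat) : eset := gen (fun g => gamma n g \/ Fin g).

Definition layered (L : eset) : Prop :=
  subgroup L /\
  (forall k u v, size u = k -> size v = k -> exists g, L g /\ g u = v) /\
  (forall (x : bool) g, L g -> L (vstar [:: x] g)).

Definition normW (A : eset) : eset :=
  fun g => isW g /\ exists g', inv_elt g g' /\
    forall a, A a <-> A (g' \o a \o g).

(* automorphism tower realized as normalizer tower in W *)
Fixpoint tower (A : eset) (m : nat) : eset :=
  match m with
  | 0 => A
  | m'.+1 => normW (tower A m')
  end.

Definition tower_height (A : eset) (h : nat) : Prop :=
  seteq (tower A h) (tower A h.+1) /\
  forall m, m < h -> ~ seteq (tower A m) (tower A m.+1).

(* Main.v *)
Require Import Defs.
From mathcomp Require Import all_boot.
From Stdlib Require Import FunctionalExtensionality Setoid.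
Set Implicit Arguments. Unset Strict Implicit. Unset Printing Implicit Defensive.

(** Encode an isometry by its portrait: [a_k(g)] is the F_2-valued function on
    level [k] recording where [g] swaps.  It satisfies the cocycle identity
    a(g h) = a(g) o h + a(h).  The functions on level [k] form a uniserial
    W-module; let P_n(k) be its submodule of codimension [min n (2^k)], so that
    [f o g + f] lies in P_(n+1)(k) when [f] lies in P_n(k).

    - gamma_(n+1)(W) = D_n := {g | a_k(g) in P_n(k) for all k}.  Inclusion from
      left to right is the cocycle identity together with the fact that
      elements of D_n move every function by an element of P_(n+1).
      Conversely, for c in D_(n+1) the equation
      h o odometer = odometer o c o h is solved for h in D_n level by level,
      so that every element of D_(n+1) is a single commutator [g, odometer]
      with g in D_n.
    - Hence L_(n+1) = E_n := {g | a_k(g) in P_n(k) for almost all k}.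
    - E_n normalizes E_(n+1) by the cocycle identity.  Conversely, if g
      normalizes E_(n+1), conjugating by g an odometer t acting only on the
      first n letters (a finitary element) gives a_k(g) o t + a_k(g) in
      P_(n+1)(k) for almost all k, and this forces a_k(g) in P_n(k). *)

Implicit Types (a f : seq bool -> bool) (g h : elt) (u v w : seq bool).

(** * Isometries and their portraits *)

(** Inverse to [portrait] on isometries: [a v] decides whether the letter after the input prefix [v]
    is flipped. *)
Fixpoint ofp a u : seq bool :=
  if u is x :: w then (x (+) a [::]) :: ofp (fun v => a (x :: v)) w else [::].

Fixpoint ofpV a u : seq bool :=
  if u is y :: w then
    (y (+) a [::]) :: ofpV (fun v => a ((y (+) a [::]) :: v)) w
  else [::].

Definition portrait g v : bool := last false (g (rcons v false)).

Ltac xor_cases :=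
  repeat match goal with
  | |- context [portrait ?g ?v] => generalize (portrait g v)
  end; clear; do ![case=> //].

Lemma ofpK a : cancel (ofp a) (ofpV a).
Proof. by move=> u; elim: u a => //= x w IH a; rewrite addbK IH. Qed.

Lemma ofpVK a : cancel (ofpV a) (ofp a).
Proof. by move=> u; elim: u a => //= x w IH a; rewrite addbK IH. Qed.

Lemma size_ofp a u : size (ofp a u) = size u.
Proof. by elim: u a => //= x w IH a; rewrite IH. Qed.

Lemma ofp_rcons a v x : ofp a (rcons v x) = rcons (ofp a v) (x (+) a v).
Proof. by elim: v a => //= y w IH a; rewrite IH. Qed.

Lemma isW_ofp a : isW (ofp a).
Proof.
split; first by exists (ofpV a); [apply: ofpK | apply: ofpVK].
split=> [u|u v]; first exact: size_ofp.
by elim: u a => [|x u IH] a /=; rewrite ?take0 ?IH.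
Qed.

Lemma portrait_ofp a v : portrait (ofp a) v = a v.
Proof. by rewrite /portrait ofp_rcons last_rcons. Qed.

Lemma isW_size g u : isW g -> size (g u) = size u.
Proof. by case=> _ []. Qed.

Lemma isW_rcons g v x : isW g -> g (rcons v x) = rcons (g v) (x (+) portrait g v).
Proof.
move=> [[g' gK _] [sz pre]].
have ex y : exists z, g (rcons v y) = rcons (g v) z.
  move: (pre v [:: y]) (sz (rcons v y)); rewrite cats1 size_rcons.
  case/lastP: (g (rcons v y)) => [|s z] /=; rewrite ?size_rcons => // + sz1; case: sz1 => <-.
  by rewrite -cats1 take_size_cat // => <-; exists z; rewrite cats1.
have [z0 e0] := ex false; have [z1 e1] := ex true.
have -> : portrait g v = z0 by rewrite /portrait e0 last_rcons.
case: x => //=; rewrite e1; congr rcons.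
suff : z0 != z1 by case: (z0); case: (z1).
apply/eqP => z01; have := congr1 g' (etrans e0 (etrans (congr1 _ z01) (esym e1))).
by rewrite !gK => /rcons_inj [].
Qed.

Lemma isW_nil g : isW g -> g [::] = [::].
Proof. by move=> gW; apply: size0nil; rewrite isW_size. Qed.

Lemma ofp_portrait g : isW g -> g = ofp (portrait g).
Proof.
move=> gW; apply: functional_extensionality.
elim/last_ind => [|v x IH]; first by rewrite isW_nil.
by rewrite isW_rcons // ofp_rcons IH.
Qed.

Lemma isW_id : isW id.
Proof. by split; [exists id | split=> // u v; rewrite take_size_cat]. Qed.

Lemma isW_comp g h : isW g -> isW h -> isW (g \o h).
Proof.
move=> [gb [gs gp]] [hb [hs hp]]; split; first exact: bij_comp.
split=> [u|u v] /=; first by rewrite gs hs.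
have <- : h u ++ drop (size u) (h (u ++ v)) = h (u ++ v).
  by rewrite -{1}(hp u v) cat_take_drop.
by rewrite -{1}(hs u) gp.
Qed.

Lemma inv_elt_sym g h : inv_elt g h -> inv_elt h g.
Proof. by move=> gh u; case: (gh u). Qed.

Lemma isW_inv_elt g h : isW g -> inv_elt g h -> isW h.
Proof.
move=> [[g' gK g'K] [gs gp]] gh.
have hs u : size (h u) = size u by rewrite -gs (gh u).1.
split; first by exists g => u; case: (gh u).
split=> // u v; apply: (can_inj gK); rewrite (gh u).1.
rewrite -(gp _ (drop (size u) (h (u ++ v)))) cat_take_drop (gh _).1.
by rewrite size_takel ?take_size_cat // hs size_cat leq_addr.
Qed.

Lemma isW_has_inv g : isW g -> exists2 h, isW h & inv_elt g h.
Proof.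
move=> gW; have [[h gK hK] _] := gW; have gh : inv_elt g h by [].
by exists h => //; apply: isW_inv_elt gh.
Qed.

Lemma portrait_id v : portrait id v = false.
Proof. by rewrite /portrait last_rcons. Qed.

Lemma portrait_comp g h v : isW g -> isW h ->
  portrait (g \o h) v = portrait g (h v) (+) portrait h v.
Proof.
move=> gW hW; rewrite {1}/portrait /= !isW_rcons // last_rcons.
by rewrite addbC.
Qed.

Lemma portrait_inv g h v : isW g -> inv_elt g h ->
  portrait h v = portrait g (h v).
Proof.
move=> gW gh; have hW := isW_inv_elt gW gh.
have := portrait_comp v gW hW.
have -> : g \o h = id by apply: functional_extensionality => u /=; case: (gh u).
by rewrite portrait_id; case: (portrait g _); case: (portrait h _).
Qed.

(** * The filtration P_n of the functions on a level *)

(* [lev k n f] says that the restriction of [f] to the words of length [k] lies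
   in the image of the [n]-th power of [f |-> f \o odometer + f], the
   submodule of codimension [min n (2 ^ k)] of the uniserial module of
   F_2-valued functions on level [k].  Splitting along the first letter makes
   it computable by recursion on [k]. *)
Fixpoint lev k n f : bool :=
  if k is k'.+1 then
    lev k' n./2 (fun w => f (false :: w)) &&
    lev k' (uphalf n) (fun w => odd n && f (false :: w) (+) f (true :: w))
  else (n == 0) || ~~ f [::].

Lemma eq_lev k n f f' : (forall v, size v = k -> f v = f' v) ->
  lev k n f = lev k n f'.
Proof.
elim: k n f f' => [|k IH] n f f' e /=; first by rewrite e.
by congr andb; apply: IH => w szw; rewrite !e //= szw.
Qed.

Lemma lev_even k n f :
  lev k.+1 n.*2 f =
  lev k n (fun w => f (false :: w)) && lev k n (fun w => f (true :: w)).
Proof. by rewrite /= doubleK uphalf_double odd_double. Qed.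

Lemma lev_odd k n f :
  lev k.+1 n.*2.+1 f =
  lev k n (fun w => f (false :: w)) &&
  lev k n.+1 (fun w => f (false :: w) (+) f (true :: w)).
Proof. by rewrite /= uphalf_double /= doubleK odd_double. Qed.

Variant half_spec : nat -> Type :=
  | HalfEven m : half_spec m.*2
  | HalfOdd m : half_spec m.*2.+1.

Lemma halfP n : half_spec n.
Proof.
by rewrite -[n]odd_double_half; case: (odd n); rewrite ?add1n ?add0n; constructor.
Qed.

Lemma lev_false k n : lev k n (fun=> false).
Proof.
elim: k n => [|k IH] n /=; first by rewrite orbT.
by rewrite IH; apply/(etrans _ (IH (uphalf n)))/eq_lev => w; rewrite andbF.
Qed.

Lemma lev0 k f : lev k 0 f.
Proof. by elim: k f => //= k IH f; rewrite !IH. Qed.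

Lemma lev_add k n f f' : lev k n f -> lev k n f' ->
  lev k n (fun v => f v (+) f' v).
Proof.
elim: k n f f' => [|k IH] n f f' /=.
  by case: (n == 0) (f _) (f' _) => [] [] [].
move=> /andP[f0 f1] /andP[f0' f1']; rewrite IH //=.
apply/(etrans _ (IH _ _ _ f1 f1'))/eq_lev => w _.
by case: (odd n) => //=; rewrite addbACA.
Qed.

Lemma lev_addE k n f f' f'' : lev k n f -> lev k n f' ->
  (forall v, f v (+) f' v = f'' v) -> lev k n f''.
Proof.
by move=> lf lf' e; rewrite -(eq_lev n (fun v _ => e v)); apply: lev_add.
Qed.

Lemma levS k n f : lev k n.+1 f -> lev k n f.
Proof.
elim: k n f => [|k IH] n f; first by move=> /= ->; rewrite orbT.
case: (halfP n) => m.
  rewrite lev_odd lev_even => /andP[f0 /IH f1]; rewrite f0.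
  by apply: lev_addE f0 f1 _ => w; rewrite addbA addbb.
rewrite -doubleS lev_even lev_odd => /andP[f0 f1].
by rewrite IH //; apply: lev_add.
Qed.

Lemma lev_leq k m n f : m <= n -> lev k n f -> lev k m f.
Proof.
move=> /subnK <-; elim: (n - m) => // d IH.
by rewrite addSn => /levS/IH.
Qed.

(** Induction on the level, with f0, f1 the restrictions of [f] to words starting with 0, 1. If the
    first letter is fixed, each half is treated by itself. If it is flipped, the halves become f1 o
    b + f0 and f0 o b' + f1, which are rewritten through f1 o b + f1 and f0 o b' + f0. *)
Lemma lev_ofp k n f a : lev k n f -> lev k n.+1 (fun v => f (ofp a v) (+) f v).
Proof.
elim: k n f a => [|k IH] n f a; first by rewrite /= addbb.
have xor3 (x y z : bool) : (x (+) y) (+) (y (+) z) = x (+) z.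
  by case: x y z => [] [] [].
have xorC3 (x y z t : bool) :
  (x (+) y) (+) (z (+) t) = (x (+) t) (+) (z (+) y).
  by case: x y z t => [] [] [] [].
case: (halfP n) => m.
  rewrite lev_even => /andP[f0 f1].
  have F0 b := IH _ _ b f0; have F1 b := IH _ _ b f1.
  case e: (a [::]).
    rewrite lev_odd /= e /=; apply/andP; split.
      apply: lev_addE (levS (F1 _)) (lev_add f1 f0) _ => w; exact: xor3.
    apply: lev_addE (F1 _) (F0 _) _ => w; exact: xorC3.
  by apply: levS; rewrite -doubleS lev_even /= e /= F0 F1.
rewrite lev_odd -doubleS lev_even => /andP[f0 f01].
have f1 : lev k m (fun w => f (true :: w)).
  by apply: lev_addE f0 (levS f01) _ => w; rewrite addbA addbb.
have F0 b := IH _ _ b f0; have F1 b := IH _ _ b f1.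
case e: (a [::]); rewrite /= e /=; last by rewrite F0 F1.
apply/andP; split.
  apply: lev_addE (F1 _) f01 _ => w; rewrite [f (false :: w) (+) _]addbC.
  exact: xor3.
apply: lev_addE (F0 _) f01 _ => w; exact: xor3.
Qed.

Lemma lev_diff k n f g : isW g -> lev k n f ->
  lev k n.+1 (fun v => f (g v) (+) f v).
Proof. by move=> /ofp_portrait ->; apply: lev_ofp. Qed.

Lemma lev_comp k n f g : isW g -> lev k n f -> lev k n (fun v => f (g v)).
Proof.
move=> gW lf; apply: lev_addE (levS (lev_diff gW lf)) lf _ => v.
by rewrite -addbA addbb addbF.
Qed.

(** Here [f] is arbitrary and the gain comes from the isometry. For n > 0 it fixes the first letter
    and its sections have portraits in P_(n./2), so by induction both halves lie in P_(n./2 + 1),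
    and 2 (n./2 + 1) >= n + 1. *)
Lemma lev_ofp_fix k n f a : (forall i, i < k -> lev i n a) ->
  lev k n.+1 (fun v => f (ofp a v) (+) f v).
Proof.
elim: k n f a => [|k IH] n f a la; first by rewrite /= addbb.
have [->|n0] := eqVneq n 0; first exact: (@lev_ofp _ 0 f a (lev0 _ f)).
have a0 : a [::] = false by apply/negbTE; have := la 0 isT; rewrite /= (negbTE n0).
have lax x i : i < k -> lev i n./2 (fun w => a (x :: w)).
  move=> ik; have := la i.+1 ik; case: (halfP n) => m.
    by rewrite lev_even doubleK => /andP[]; case: x.
  rewrite lev_odd /= uphalf_double => /andP[l0 /levS l1]; case: x => //.
  by apply: lev_addE l0 l1 _ => w; rewrite addbA addbb.
apply: (@lev_leq _ _ (n./2.+1).*2).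
  by rewrite doubleS !ltnS -{1}[n]odd_double_half -add1n leq_add2r leq_b1.
by rewrite lev_even /= a0 /= !IH // => i; apply: lax.
Qed.

Lemma lev_fix k n f g : isW g -> (forall i, i < k -> lev i n (portrait g)) ->
  lev k n.+1 (fun v => f (g v) (+) f v).
Proof. by move=> /ofp_portrait {2}->; apply: lev_ofp_fix. Qed.

(** * The odometer and its difference equation *)

Definition odo : elt := ofp (all id).

(* [antidiff^~ f] is the solution of [F \o odo + F = f] vanishing at the words
   [0...0]; it exists when [f] has zero sum on the level, see [antidiffP]. *)
Fixpoint antidiff u f : bool :=
  if u is x :: w then
    antidiff w (fun v => f (false :: v) (+) f (true :: v)) (+) (x && f (false :: w))
  else false.

(** The halves of the solution are A and A + f0, where A solves the equation for f0 + f1 one level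
    down. For even n both must lie in P_(n/2); for odd n the sum of the halves is just f0. *)
Lemma lev_antidiff k n f : lev k n.+1 f -> lev k n (antidiff^~ f).
Proof.
elim: k n f => [|k IH] n f; first by rewrite /= orbT.
case: (halfP n) => m.
  rewrite lev_odd lev_even => /andP[f0 f01]; rewrite /=.
  apply/andP; split; first by apply: lev_addE (IH _ _ f01) (lev_false _ _) _.
  by apply: lev_add => //; apply: IH.
rewrite -doubleS lev_even lev_odd => /andP[f0 f1] /=; apply/andP; split.
  by apply: lev_addE (IH _ _ (lev_add f0 f1)) (lev_false _ _) _.
apply: lev_addE f0 (lev_false _ _) _ => w.
by rewrite !addbF addbA addbb.
Qed.

Lemma odo_cons x w : odo (x :: w) = (~~ x) :: (if x then odo w else w).
Proof.
rewrite /odo /= addbT; case: x => //=; congr cons.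
by elim: w => //= x w IH; rewrite addbF IH.
Qed.

Lemma antidiffP k f u : size u = k -> lev k 1 f ->
  antidiff (odo u) f (+) antidiff u f = f u.
Proof.
elim: u k f => [|x w IH] [|k] f //; first by move=> _ /= /negbTE ->.
move=> [szw] /andP[_ lf]; rewrite odo_cons; case: x => /=.

  by rewrite addbF addbA (IH k) //= addbAC addbb.
by rewrite addbF addbAC addbb.
Qed.

Lemma eq_antidiff u f f' : (forall v, size v = size u -> f v = f' v) ->
  antidiff u f = antidiff u f'.
Proof.
elim: u f f' => //= x w IH f f' e.
rewrite (IH _ (fun v => f' (false :: v) (+) f' (true :: v))) ?e // => v szv.
by rewrite !e //= szv.
Qed.

Lemma eq_ofp a a' u : (forall v, size v < size u -> a v = a' v) ->
  ofp a u = ofp a' u.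
Proof.
elim: u a a' => //= x w IH a a' e; rewrite e //; congr cons.
by apply: IH => v szv; apply: e.
Qed.

Lemma ofp_false u : ofp (fun=> false) u = u.
Proof. by elim: u => //= x w ->; rewrite addbF. Qed.

(** On words of length k, [ofp a] involves [a] on shorter words only, so the fixed-point equation is
    a recursion on levels. *)
Lemma portrait_rec (F : seq bool -> elt -> bool) :
  (forall v g g', (forall w, size w = size v -> g w = g' w) -> F v g = F v g') ->
  exists a, forall v, a v = F v (ofp a).
Proof.
move=> Floc.
(* [p k] is the solution on levels below [k], extended by [false]. *)
pose fix p k := if k is k'.+1 then
  fun v => if size v == k' then F v (ofp (p k')) else p k' v else fun=> false.
pose a v := p (size v).+1 v.
have pa k v : size v < k -> p k v = a v.
  elim: k => // k IH; rewrite ltnS leq_eqVlt /= /a /= eqxx.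
  by case: eqP => [-> //|_] /= /IH ->; rewrite /a /= eqxx.
exists a => v; rewrite {1}/a /= eqxx; apply: Floc => w szw.
by apply: eq_ofp => v' szv'; apply: pa; rewrite -szw.
Qed.

(** * Subgroups of W and conditions on portraits *)

Lemma inv_elt_unique g h h' : inv_elt g h -> inv_elt g h' -> h = h'.
Proof.
move=> gh gh'; apply: functional_extensionality => u.
by rewrite -{1}(gh' u).1 (gh _).2.
Qed.

Lemma subgroup_inv H g h : subgroup H -> H g -> inv_elt g h -> H h.
Proof.
move=> [_ [_ [_ Hinv]]] /Hinv [h' [Hh' gh']] gh.
by rewrite (inv_elt_unique gh gh').
Qed.

Lemma subgroup_isW : subgroup isW.
Proof.
split=> //; split; first exact: isW_id.
split; first exact: isW_comp.
by move=> g /isW_has_inv [h hW gh]; exists h.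
Qed.

Lemma gen_subgroup (S : eset) : (forall s, S s -> isW s) -> subgroup (gen S).
Proof.
move=> SW; have genW g : gen S g -> isW g by apply=> //; apply: subgroup_isW.
split=> //; split; first by move=> H [_ []].
split=> [g h gS hS H HH SH|g gS].
  by have [_ [_ [Hc _]]] := HH; apply: Hc; [apply: gS | apply: hS].
have [h hW gh] := isW_has_inv (genW _ gS); exists h; split=> // H HH SH.
by apply: subgroup_inv gh => //; apply: gS.
Qed.

Lemma gen_mem (S : eset) g : S g -> gen S g.
Proof. by move=> Sg H _; apply. Qed.

Lemma lev_portrait_comp k n g h : isW g -> isW h ->
  lev k n (portrait g) -> lev k n (portrait h) -> lev k n (portrait (g \o h)).
Proof.
move=> gW hW lg lh; apply: lev_addE (lev_comp hW lg) lh _ => v.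
by rewrite portrait_comp.
Qed.

Lemma lev_portrait_inv k n g h : isW g -> inv_elt g h ->
  lev k n (portrait g) -> lev k n (portrait h).
Proof.
move=> gW gh lg; rewrite (eq_lev n (f' := fun v => portrait g (h v))).
  exact: lev_comp (isW_inv_elt gW gh) lg.
by move=> v _; apply: portrait_inv.
Qed.

Definition Dgrp n : eset :=
  fun g => isW g /\ forall k, lev k n (portrait g).

Definition Egrp n : eset :=
  fun g => isW g /\ exists K, forall k, K <= k -> lev k n (portrait g).

Lemma lev_portrait_id k n : lev k n (portrait id).
Proof.
rewrite (eq_lev n (f' := fun=> false)) ?lev_false // => v _.
exact: portrait_id.
Qed.

Lemma Dgrp_subgroup n : subgroup (Dgrp n).
Proof.
split; first by move=> g [].
split; first by split; [exact: isW_id | move=> k; exact: lev_portrait_id].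
split=> [g h [gW gl] [hW hl]|g [gW gl]].
  by split=> [|k]; [exact: isW_comp | exact: lev_portrait_comp].
have [h hW gh] := isW_has_inv gW; exists h; split=> //; split=> // k.
exact: lev_portrait_inv gh (gl k).
Qed.

Lemma Egrp_subgroup n : subgroup (Egrp n).
Proof.
split; first by move=> g [].
split.
  by split; [exact: isW_id | exists 0 => k _; exact: lev_portrait_id].
split=> [g h [gW [K gl]] [hW [K' hl]]|g [gW [K gl]]].
  split; first exact: isW_comp.
  exists (maxn K K') => k; rewrite geq_max => /andP[/gl lg /hl lh].
  exact: lev_portrait_comp.
have [h hW gh] := isW_has_inv gW; exists h; split=> //; split=> //.
by exists K => k /gl; apply: lev_portrait_inv gh.
Qed.

(** * The lower central series of W *)

(** Identifying elements with their portraits, a b = b a c reads c = (a o b + a) + (a o c + a) + (b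
    o (a c) + b). The last term is handled by [lev_fix], since by induction a c satisfies the
    condition for P_n on all lower levels. *)
Lemma commutator_lev (a b c : elt) n : isW a -> isW b -> isW c ->
  (forall u, a (b u) = b (a (c u))) ->
  (forall k, lev k n (portrait a)) -> forall k, lev k n.+1 (portrait c).
Proof.
move=> aW bW cW e la; elim/ltn_ind => k IH.
have acW := isW_comp aW cW.
have lac i : i < k -> lev i n (portrait (a \o c)).
  by move=> ik; apply: lev_portrait_comp => //; apply/levS/IH.
have lB := lev_fix (portrait b) acW lac.
have lA := lev_add (lev_diff bW (la k)) (lev_diff cW (la k)).
apply: lev_addE lA lB _ => v.
have ev : portrait (a \o b) v = portrait (b \o (a \o c)) v.
  by congr portrait; apply: functional_extensionality.
move: ev; rewrite (portrait_comp v aW bW) (portrait_comp v bW acW).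
by rewrite (portrait_comp v aW cW) /=; xor_cases.
Qed.

Lemma odo_conjugator (c : elt) n : Dgrp n.+1 c ->
  exists h, Dgrp n h /\ forall u, h (odo u) = odo (c (h u)).
Proof.
move=> [cW lc]; have oW : isW odo by apply: isW_ofp.
have tW : isW (odo \o c) by apply: isW_comp.
(* On portraits the equation becomes h o odo + h = r h, and r h on level k depends on the portrait
   of h below level k only. *)
pose r (g : elt) w := portrait odo w (+) portrait (odo \o c) (g w).
have [v g g' e|a ea] := @portrait_rec (fun v g => antidiff v (r g)).
  by apply: eq_antidiff => w szw; rewrite /r e.
have hW := isW_ofp a; set h := ofp a in ea hW.
have la k : lev k n a /\ lev k n.+1 (r h).
  elim/ltn_ind: k => k IH.
  suff lr : lev k n.+1 (r h).
    by split=> //; rewrite (eq_lev n (f' := antidiff^~ (r h))) //; apply: lev_antidiff.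
  have lch i : i < k -> lev i n (portrait (c \o h)).
    move=> ik; apply: lev_portrait_comp => //; first exact/levS/lc.
    by rewrite (eq_lev n (f' := a)) ?(IH i ik).1 // => v _; apply: portrait_ofp.
  have lo := lev_fix (portrait odo) (isW_comp cW hW) lch.
  apply: lev_addE lo (lev_comp hW (lc k)) _ => v.
  by rewrite /r (portrait_comp _ oW cW) /=; xor_cases.
exists h; split.
  by split=> // k; rewrite (eq_lev n (f' := a)) ?(la k).1 // => v _; apply: portrait_ofp.
elim/last_ind => [|v x IH]; first by rewrite !(isW_nil hW) !(isW_nil cW).
rewrite (isW_rcons _ _ oW) !(isW_rcons _ _ hW) (isW_rcons _ _ cW) (isW_rcons _ _ oW).
rewrite IH; congr rcons; rewrite !(portrait_ofp a).
(* Lying in P_1 means having zero sum on the level, which makes the difference equation solvable. *)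
have l1 : lev (size v) 1 (r h) by apply: lev_leq (la _).2.
have := antidiffP erefl l1; rewrite -!ea /r (portrait_comp _ oW cW).
by move: x (a (odo v)) (a v); xor_cases.
Qed.

Lemma gam_Dgrp n g : gam n g <-> Dgrp n g.
Proof.
elim: n g => [|n IH] g /=; first by split=> [gW|[]] //; split=> // k; apply: lev0.
split=> [|gD].
  apply; first exact: Dgrp_subgroup.
  move=> c [a [b [a' [b' [/IH [aW la] [bW [aa' [bb' ec]]]]]]]].
  have cW : isW c.
    have -> : c = a' \o (b' \o (a \o b)) by apply: functional_extensionality.
    have [aW' bW'] := (isW_inv_elt aW aa', isW_inv_elt bW bb').
    exact: isW_comp aW' (isW_comp bW' (isW_comp aW bW)).
  split=> //; apply: (commutator_lev aW bW cW) => // u.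
  by rewrite ec (aa' _).1 (bb' _).1.
(* Commutators have the form a^-1 b^-1 a b, so the conjugator is taken for c = g^-1: then g = h
   odo^-1 h^-1 odo. *)
have [gW _] := gD; have [c _ gc] := isW_has_inv gW.
have cD := subgroup_inv (Dgrp_subgroup _) gD gc.
have [h [hD eh]] := odo_conjugator cD; have [hW _] := hD.
have [h' hW' hh'] := isW_has_inv hW.
have oW : isW odo by apply: isW_ofp.
have [o' oW' oo'] := isW_has_inv oW.
apply: gen_mem; exists h', odo, h, o'; split.
  exact/IH/(subgroup_inv (Dgrp_subgroup _) hD).
split=> //; split; first exact: inv_elt_sym.
split=> // u; rewrite -{2}(gc u).2.
have -> : o' (h' (odo (c (g u)))) = h' (g u).
  by rewrite -{1}(hh' (g u)).1 -eh (hh' _).2 (oo' _).2.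
by rewrite (hh' _).1.
Qed.

(** * The finitary group *)

Lemma vstar_comp v g h : vstar v (g \o h) = vstar v g \o vstar v h.
Proof.
apply: functional_extensionality => u; rewrite /vstar /=.
case: eqP => [e|/eqP/negbTE e]; last by rewrite e.
by rewrite take_size_cat // eqxx drop_size_cat.
Qed.

Lemma vstar_id v : vstar v id = id.
Proof.
apply: functional_extensionality => u; rewrite /vstar.
by case: eqP => // e; rewrite -{1}e cat_take_drop.
Qed.

Lemma vstar_inv v g h : inv_elt g h -> inv_elt (vstar v g) (vstar v h).
Proof.
move=> gh; suff K g1 g2 : cancel g1 g2 -> cancel (vstar v g1) (vstar v g2).
  by move=> u; split; apply: K => w; case: (gh w).
move=> gK u; have := congr1 (fun h : elt => h u) (vstar_comp v g2 g1).
have -> : g2 \o g1 = id by apply: functional_extensionality.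
by rewrite vstar_id.
Qed.

Lemma vstar_cons x v g : vstar (x :: v) g = vstar [:: x] (vstar v g).
Proof.
apply: functional_extensionality => -[|y w] //.
rewrite /vstar /= take0 drop0 !eqseq_cons eqxx andbT.
by case: (eqVneq y x) => [->|_] //=; case: ifP.
Qed.

Lemma vstar_ofp x a :
  vstar [:: x] (ofp a) = ofp (fun v => if v is y :: w then (y == x) && a w else false).
Proof.
apply: functional_extensionality => -[|y w] //.
rewrite /vstar /= take0 drop0 eqseq_cons eqxx andbT addbF.
by case: eqP => [->|_] //=; rewrite ofp_false.
Qed.

Lemma vstar_sigma v : vstar v sigma = ofp (pred1 v).
Proof.
elim: v => [|x v IH].
  apply: functional_extensionality => -[|y w] //=.
  by rewrite /vstar /= addbT ofp_false.
by rewrite vstar_cons IH vstar_ofp; congr ofp.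
Qed.

Lemma Fin_subgroup : subgroup Fin.
Proof. by apply: gen_subgroup => s [v ->]; rewrite vstar_sigma; apply: isW_ofp. Qed.

Lemma Fin_gen v : Fin (vstar v sigma).
Proof. by apply: gen_mem; exists v. Qed.

Lemma Fin_comp g h : Fin g -> Fin h -> Fin (g \o h).
Proof. by have [_ [_ [Hc _]]] := Fin_subgroup; apply: Hc. Qed.

Lemma Fin_id : Fin id.
Proof. by have [_ []] := Fin_subgroup. Qed.

Lemma Fin_vstar x g : Fin g -> Fin (vstar [:: x] g).
Proof.
move=> gF; pose H g := isW g /\ Fin (vstar [:: x] g).
suff [] : H g by [].
apply: gF => [|_ [v ->]]; last first.
  rewrite /H -vstar_cons; split; last exact: Fin_gen.
  by rewrite vstar_sigma; apply: isW_ofp.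
split; first by move=> h [].
split; first by split; [exact: isW_id | rewrite vstar_id; exact: Fin_id].
split=> [h h' [hW hF] [hW' hF']|h [hW hF]].
  by split; [exact: isW_comp | rewrite vstar_comp; exact: Fin_comp].
have [h' hW' hh'] := isW_has_inv hW; exists h'; split=> //; split=> //.
exact: subgroup_inv Fin_subgroup hF (vstar_inv _ hh').
Qed.

(** By induction on the depth [K]: act on the two subtrees first, then swap them if [a [::]]
    holds. *)
Lemma Fin_ofp K a : (forall v, K <= size v -> a v = false) -> Fin (ofp a).
Proof.
elim: K a => [|K IH] a aK.
  have -> : ofp a = id; last exact: Fin_id.
  apply: functional_extensionality => u; rewrite -[RHS]ofp_false.
  by apply: eq_ofp => v _; apply: aK.
have Fx x : Fin (vstar [:: x] (ofp (fun w => a (x :: w)))).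
  by apply: (Fin_vstar x (IH _ _)) => v Kv; apply: aK.
have Fs : Fin (if a [::] then vstar [::] sigma else id).
  by case: (a _); [apply: Fin_gen | apply: Fin_id].
have := Fin_comp Fs (Fin_comp (Fx false) (Fx true)).
set g := _ \o _; suff -> : ofp a = g by [].
apply: functional_extensionality => -[|x w]; rewrite /g /=; first by case: (a _).
by rewrite vstar_sigma !vstar_ofp; case: x; case: (a [::]); rewrite /= !ofp_false.
Qed.

(** * The groups L_n and their layeredness *)

Lemma Lgrp_Egrp n : 0 < n -> seteq (Lgrp n) (Egrp n.-1).
Proof.
case: n => // n _ g; rewrite /Lgrp /gamma /=.
have LW s : gam n s \/ Fin s -> isW s.
  by case=> [/gam_Dgrp []|] //; have [FW _] := Fin_subgroup; apply: FW.
split=> [|[gW [K gl]]].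
  apply; first exact: Egrp_subgroup.
  move=> s [/gam_Dgrp [sW sl]|]; first by split=> //; exists 0.
  apply; first exact: Egrp_subgroup.
  move=> _ [v ->]; rewrite vstar_sigma; split; first exact: isW_ofp.
  exists (size v).+1 => k szv; rewrite (eq_lev n (f' := fun=> false)) ?lev_false //.
  move=> w szw; rewrite portrait_ofp /=; apply/eqP => wv.
  by rewrite wv in szw; rewrite szw ltnn in szv.
have [_ [_ [Lc _]]] := gen_subgroup LW.
(* [t] is [g] cut off at level [K], hence finitary. The portrait of g t^-1 vanishes below [K] and is
   that of [g] composed with t^-1 from [K] on, so it satisfies the condition on every level. *)
pose t := ofp (fun v => (size v < K) && portrait g v).
have tW : isW t := isW_ofp _.
have tF : Fin t by apply: (@Fin_ofp K) => v; rewrite leqNgt => /negbTE ->.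
have [t' tW' tt'] := isW_has_inv tW.
have -> : g = (g \o t') \o t.
  by apply: functional_extensionality => u /=; rewrite (tt' u).2.
apply: Lc; apply: gen_mem; [left | by right].
apply/gam_Dgrp; split=> [|k]; first exact: isW_comp.
have e v : portrait (g \o t') v = (K <= size v) && portrait g (t' v).
  rewrite portrait_comp // (portrait_inv _ tW tt') portrait_ofp (isW_size _ tW').
  by rewrite ltnNge; case: leqP => //=; rewrite ?addbb ?addbF.
have [Kk|kK] := leqP K k.
  rewrite (eq_lev n (f' := fun v => portrait g (t' v))); last first.
    by move=> v szv; rewrite e szv Kk.
  exact/lev_comp/gl.
rewrite (eq_lev n (f' := fun=> false)) ?lev_false // => v szv.
by rewrite e szv leqNgt kK.
Qed.

Lemma Fin_transitive u v : size u = size v -> exists2 g, Fin g & g u = v.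
Proof.
elim: u v => [|x u IH] [|y v] // => [_|[/IH [g gF guv]]].
  by exists id => //; apply: Fin_id.
exists ((if x (+) y then vstar [::] sigma else id) \o vstar [:: x] g).
  apply: Fin_comp; last exact: Fin_vstar.
  by case: (x (+) y); [apply: Fin_gen | apply: Fin_id].
rewrite /= /vstar /= take0 drop0 eqxx /= guv.
by case: x; case: y => //=; rewrite drop0.
Qed.

(** Extension by zero from one subtree: splitting off the first letter requires of [f] at most the
    index [uphalf n], which is at most [n]. *)
Lemma lev_section x k n f : lev k n f ->
  lev k.+1 n (fun v => if v is y :: w then (y == x) && f w else false).
Proof.
move=> lf; case: (halfP n) lf => m lf.
  have lm : lev k m f by apply: lev_leq lf; rewrite -addnn leq_addr.
  by rewrite lev_even; case: x; rewrite /= ?lm ?lev_false.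
have lm : lev k m.+1 f by apply: lev_leq lf; rewrite ltnS -addnn leq_addr.
rewrite lev_odd; case: x; first by rewrite lev_false /=.
rewrite levS //=; apply: lev_addE lm (lev_false _ _) _ => w //.
Qed.

Lemma Egrp_vstar n x g : Egrp n g -> Egrp n (vstar [:: x] g).
Proof.
move=> [gW [K gl]]; rewrite (ofp_portrait gW) vstar_ofp.
split; first exact: isW_ofp.
exists K.+1 => -[|k] // /gl /(lev_section x) lk.
by rewrite (eq_lev n (fun v _ => portrait_ofp _ v)).
Qed.

Lemma Lgrp_layered n : 0 < n -> layered (Lgrp n).
Proof.
move=> n0; have LE := Lgrp_Egrp n0.
split.
  apply: gen_subgroup => s [/gam_Dgrp []|] //.
  by have [FW _] := Fin_subgroup; apply: FW.
split=> [k u v <- /esym uv|x g /LE /Egrp_vstar gE]; last exact/LE.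
have [g gF guv] := Fin_transitive uv.
by exists g; split=> //; apply: gen_mem; right.
Qed.

(** * Normalizers of the groups E_n *)

(** For c = g^-1 b g, comparing portraits in g c = b g gives c = (g o c + g) + b o g. *)
Lemma Egrp_conj n g g' (b : elt) : Egrp n g -> inv_elt g g' ->
  Egrp n.+1 b -> Egrp n.+1 (g' \o b \o g).
Proof.
move=> [gW [K gl]] gg' [bW [K' bl]]; have gW' := isW_inv_elt gW gg'.
set c := _ \o _; have cW : isW c := isW_comp (isW_comp gW' bW) gW.
split=> //; exists (maxn K K') => k; rewrite geq_max => /andP[/gl lg /bl lb].
apply: lev_addE (lev_diff cW lg) (lev_comp gW lb) _ => v.
have gc : g \o c = b \o g.
  by apply: functional_extensionality => u; rewrite /c /= (gg' _).1.
have := congr1 (fun h => portrait h v) gc.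
rewrite (portrait_comp v gW cW) (portrait_comp v bW gW).
by xor_cases.
Qed.

Definition odo_trunc r : elt := ofp (fun v => all id v && (size v < r)).

Lemma odo_trunc_cons r x w : odo_trunc r.+1 (x :: w) = (~~ x) :: (if x then odo_trunc r w else w).
Proof. by rewrite /odo_trunc /= addbT; case: x => //=; rewrite ofp_false. Qed.

(** A converse of [lev_diff] for one finitary element t. Since t alternates between the halves and
    t^2 acts on the half 0 as the truncation of depth r - 1, the hypothesis controls f0 + f1 and the
    difference of f0 one level down. The bound n < 2^r survives halving and forces n = 0 when r =
    0. *)
Lemma lev_odo_trunc r k n f : n < 2 ^ r -> r <= k ->
  lev k n.+1 (fun v => f (odo_trunc r v) (+) f v) -> lev k n f.
Proof.
elim: r k n f => [|r IH] [|k] n f //; [by case: n | by case: n => // _ _ _; apply: lev0 |].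
rewrite ltnS expnS mul2n => nr rk.
case: (halfP n) nr => m nr.
  rewrite lev_odd lev_even => /andP[l01 l0].
  have {}l0 : lev k m (fun w => f (false :: w)).
    apply: IH => //; first by rewrite -ltn_double.
    apply: lev_addE l0 (lev_false _ _) _ => w; rewrite !odo_trunc_cons addbF.
    by rewrite [f (true :: w) (+) f (false :: w)]addbC addbACA addbb addbF addbC.
  rewrite l0; apply: lev_addE l01 l0 _ => w.
  by rewrite odo_trunc_cons -addbA addbb addbF.
rewrite -doubleS lev_even lev_odd => /andP[l0 l1].
have l01 : lev k m.+1 (fun w => f (false :: w) (+) f (true :: w)).
  by apply: lev_addE l0 (lev_false _ _) _ => w; rewrite odo_trunc_cons addbF addbC.
rewrite l01 andbT; apply: IH => //.
  by rewrite -ltn_double; apply: leq_trans nr.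
apply: lev_addE l1 l01 _ => w; rewrite odo_trunc_cons.
by rewrite [f (false :: w) (+) f (true :: w)]addbC addbA addbK.
Qed.

Lemma normW_Egrp n : seteq (normW (Egrp n.+1)) (Egrp n).
Proof.
move=> g; split=> [[gW [g' [gg' gN]]]|gE]; last first.
  have [gW _] := gE; have [g' gW' gg'] := isW_has_inv gW.
  split=> //; exists g'; split=> // b; split=> [|bE]; first exact: Egrp_conj.
  have gE' := subgroup_inv (Egrp_subgroup n) gE gg'.
  have -> : b = g \o (g' \o b \o g) \o g'.
    by apply: functional_extensionality => u /=; rewrite !(gg' _).1.
  exact: Egrp_conj gE' (inv_elt_sym gg') bE.
split=> //; have gW' := isW_inv_elt gW gg'.
(* Depth [n] suffices because n < 2^n. *)
pose t := odo_trunc n; have tW : isW t := isW_ofp _.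
have tk k v : n <= k -> size v = k -> portrait t v = false.
  by move=> nk szv; rewrite portrait_ofp szv ltnNge nk andbF.
have tE : Egrp n.+1 t.
  split=> //; exists n => k nk.
  by rewrite (eq_lev n.+1 (tk k ^~ nk)) lev_false.
pose b : elt := g \o t \o g'.
have bW : isW b := isW_comp (isW_comp gW tW) gW'.
have [_ [K bl]] : Egrp n.+1 b.
  apply/gN; suff -> : g' \o b \o g = t by [].
  by apply: functional_extensionality => u; rewrite /b /= !(gg' _).2.
exists (maxn K n) => k; rewrite geq_max => /andP[/bl lb nk].
apply: (@lev_odo_trunc n) => //; first exact: ltn_expl.
(* The portrait of [t] vanishes from level [n] on, so there b g = g t reads g o t + g = b o g. *)
rewrite (eq_lev _ (f' := fun v => portrait b (g v))); first exact: lev_comp.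
move=> v szv; have bg : b \o g = g \o t.
  by apply: functional_extensionality => u; rewrite /b /= (gg' _).2.
have := congr1 (fun h => portrait h v) bg.
rewrite (portrait_comp v bW gW) (portrait_comp v gW tW).
rewrite (tk k v) // -/t.
by xor_cases.
Qed.

Lemma normW_ext (A B : eset) : seteq A B -> seteq (normW A) (normW B).
Proof.
move=> AB g; split=> -[gW [g' [gg' gN]]]; split=> //; exists g'; split=> // a.
  exact: iff_trans (iff_sym (AB a)) (iff_trans (gN a) (AB _)).
exact: iff_trans (AB a) (iff_trans (gN a) (iff_sym (AB _))).
Qed.

Lemma normW_W : seteq (normW isW) isW.
Proof.
move=> g; split=> [[]|gW] //.
have [g' gW' gg'] := isW_has_inv gW; split=> //; exists g'; split=> // a.
split=> aW; first exact: isW_comp (isW_comp gW' aW) gW.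
have -> : a = g \o (g' \o a \o g) \o g'.
  by apply: functional_extensionality => u /=; rewrite !(gg' _).1.
exact: isW_comp (isW_comp gW aW) gW'.
Qed.

(** * Strictness of the filtration and the tower *)

(** For j < 2^(size u) this is, by Lucas, the binomial coefficient of j over u modulo 2, where [u]
    is read in binary with the lowest digit first. *)
Fixpoint lev_wit j u : bool :=
  if u is x :: w then lev_wit j./2 w && (odd j || ~~ x) else j == 0.

Lemma lev_witP k j : j < 2 ^ k -> lev k j (lev_wit j) && ~~ lev k j.+1 (lev_wit j).
Proof.
elim: k j => [|k IH] j; first by case: j.
rewrite expnS mul2n; case: (halfP j) => m jk.
  have /andP[l nl] : lev k m (lev_wit m) && ~~ lev k m.+1 (lev_wit m).
    by apply: IH; rewrite -ltn_double.
  rewrite lev_even lev_odd /= odd_double doubleK /=.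
  have e x : (fun w => lev_wit m w && x) = if x then lev_wit m else fun=> false.
    by apply: functional_extensionality => w; case: x; rewrite ?andbT ?andbF.
  have e' : (fun w => lev_wit m w && true (+) lev_wit m w && false) = lev_wit m.
    by apply: functional_extensionality => w; rewrite andbT andbF addbF.
  by rewrite e' !e l lev_false (negbTE nl).
have /andP[l nl] : lev k m (lev_wit m) && ~~ lev k m.+1 (lev_wit m).
  by apply: IH; rewrite -ltn_double; apply: ltnW.
have e : (fun w => lev_wit m w && true) = lev_wit m.
  by apply: functional_extensionality => w; rewrite andbT.
have e' : (fun w => lev_wit m w && true (+) lev_wit m w && true) = fun=> false.
  by apply: functional_extensionality => w; rewrite addbb.
rewrite lev_odd -doubleS lev_even /= odd_double uphalf_double /=.
by rewrite e e' l lev_false (negbTE nl).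
Qed.

(** One isometry, with portrait [lev_wit j], separates the groups: on every level k >= j, where j <
    2^k, it lies in P_j and not in P_(j+1). *)
Lemma Egrp_neq j : ~ seteq (Egrp j.+1) (Egrp j).
Proof.
move=> E.
have lw n k : lev k n (portrait (ofp (lev_wit j))) = lev k n (lev_wit j).
  by apply: eq_lev => v _; apply: portrait_ofp.
have jk k : j <= k -> j < 2 ^ k by move=> jk; apply: leq_ltn_trans (ltn_expl k _).
have [_ [K]] : Egrp j.+1 (ofp (lev_wit j)).
  apply/E; split; first exact: isW_ofp.
  by exists j => k /jk /lev_witP /andP[l _]; rewrite lw.
move/(_ (maxn K j) (leq_maxl _ _)); rewrite lw; apply/negP.
by have /lev_witP/andP[] := jk _ (leq_maxr K j).
Qed.

Lemma Egrp0 : seteq (Egrp 0) isW.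
Proof. by move=> g; split=> [[]|gW] //; split=> //; exists 0 => k _; apply: lev0. Qed.

Lemma tower_Egrp n m : 0 < n -> m < n -> seteq (tower (Lgrp n) m) (Egrp (n.-1 - m)).
Proof.
move=> n0; elim: m => [|m IH] mn; first by rewrite subn0; apply: Lgrp_Egrp.
have e : n.-1 - m = (n.-1 - m.+1).+1 by rewrite subnSK // -ltnS prednK.
move=> g; have := normW_ext (IH (ltnW mn)) g; rewrite e => h.
by rewrite /= h; apply: normW_Egrp.
Qed.

Theorem theorem4p11 (n : nat) (hn : 1 <= n) :
  layered (Lgrp n) /\ tower_height (Lgrp n) (n - 1) /\
  (forall m, m <= n - 1 -> seteq (tower (Lgrp n) m) (Lgrp (n - m))).
Proof.
have ltn m : m <= n - 1 -> m < n by rewrite subn1 -ltnS prednK.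
split; first exact: Lgrp_layered.
split; last first.
  move=> m /ltn mn g; rewrite (tower_Egrp hn mn) Lgrp_Egrp ?subn_gt0 //.
  by rewrite -!subn1 subnAC.
split.
  have T g : tower (Lgrp n) (n - 1) g <-> isW g.
    by rewrite (tower_Egrp hn (ltn _ (leqnn _))) -subn1 subnn; apply: Egrp0.
  by move=> g; rewrite T /= (normW_ext T); apply: iff_sym; apply: normW_W.
move=> m mn E; apply: (@Egrp_neq (n.-1 - m.+1)) => g.
rewrite -(tower_Egrp hn (m := m.+1)) ?(ltn m.+1) //.
have -> : (n.-1 - m.+1).+1 = n.-1 - m by rewrite subnSK // -subn1.
by rewrite -(tower_Egrp hn (ltn _ (ltnW mn))); apply: E.
Qed.
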